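(* Let $n>1$ be an integer, $m_1,m_2>0$, and let $f,r,\theta$ be smooth functions on an open interval containing $0$, with $r>0$. The functions $$x(t)=(0,0,f(t)),$$ $$y^j(t)=\Big(r(t)\cos\big(\theta(t)+\tfrac{2(j-1)\pi}{n}\big),\ r(t)\sin\big(\theta(t)+\tfrac{2(j-1)\pi}{n}\big),\ -\tfrac{m_1}{nm_2}f(t)\Big),\quad j=1,\dots,n,$$ provide a solution of the $(n+1)$-body problem, with mass $m_1$ for the body $x$ and mass $m_2$ for each of the bodies $y^1,\dots,y^n$, if and only if $$\ddot f=-\frac{(m_1+nm_2)f}{h^3},\qquad \ddot r=\frac{c_1^2}{r^3}-a_n\frac{m_2}{r^2}-\frac{m_1r}{h^3},\qquad r^2\dot\theta=c_1,$$ where $h=\sqrt{r^2+\big(\frac{m_1+nm_2}{nm_2}\big)^2f^2}$, $c_1=y_1(0)\dot y_2(0)-y_2(0)\dot y_1(0)$ with $(y_1,y_2)$ the first two coordinates of $y^1$, and $$a_n=\sum_{j=1}^{n-1}\frac{1-e^{2\pi ji/n}}{|e^{2\pi ji/n}-1|^3}.$$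
   Context: The gravitational constant is $1$. The $(n+1)$-body problem for bodies with positions $p_0,\dots,p_n\in\mathbb{R}^3$ and masses $\mu_0,\dots,\mu_n$ is the system $\ddot p_i=\sum_{j\ne i}\frac{\mu_j(p_j-p_i)}{|p_j-p_i|^3}$, $i=0,\dots,n$. *)

(* Defs.v *)
From HB Require Import structures.
From mathcomp Require Export all_boot all_order all_algebra.
From mathcomp Require Export boolp classical_sets set_interval reals.
From mathcomp Require Export topology normedtype derive trigo.
From mathcomp Require Export complex.

Set Implicit Arguments.
Unset Strict Implicit.
Unset Printing Implicit Defensive.

Import Order.TTheory GRing.Theory Num.Theory numFieldNormedType.Exports.

Local Open Scope ring_scope.
Local Open Scope classical_set_scope.

(* Iterated derivatives are taken for total functions; on an open set they only
   depend on the restriction of the function to that set. *)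
Definition smooth_on (R : realType) (I : set R) (f : R -> R) : Prop :=
  forall (k : nat) (t : R), I t -> derivable f^`(k) t 1.

Definition vec3 (R : realType) (a b c : R) : 'rV[R]_3 :=
  \row_(k < 3) [:: a; b; c]`_k.

(* The library norm on matrices is the sup norm, hence this definition. *)
Definition euclid_norm (R : realType) (d : nat) (v : 'rV[R]_d) : R :=
  Num.sqrt (\sum_(k < d) v 0 k ^+ 2).

(* Division by 0 is total, so the absence of collisions is part of being a
   solution. *)
Definition nbody_solution (R : realType) (I : set R) (n : nat)
    (mu : 'I_n.+1 -> R) (p : 'I_n.+1 -> R -> 'rV[R]_3) : Prop :=
  forall t : R, I t ->
    (forall i j : 'I_n.+1, i != j -> p i t != p j t) /\
    (forall i : 'I_n.+1,
      [/\ derivable (p i) t 1,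
          derivable (p i)^`() t 1
        & (p i)^`(2) t =
          \sum_(j < n.+1 | j != i)
            (mu j / euclid_norm (p j t - p i t) ^+ 3) *: (p j t - p i t)]).

Definition body_x (R : realType) (f : R -> R) (t : R) : 'rV[R]_3 :=
  vec3 0 0 (f t).

Definition body_y (R : realType) (n : nat) (m1 m2 : R) (f r theta : R -> R)
    (j : nat) (t : R) : 'rV[R]_3 :=
  let phi := theta t + 2 * (j%:R - 1) * pi / n%:R in
  vec3 (r t * cos phi) (r t * sin phi) (- (m1 / (n%:R * m2)) * f t).

(* Body 0 is x and body j, for 1 <= j <= n, is y^j. *)
Definition bodies (R : realType) (n : nat) (m1 m2 : R) (f r theta : R -> R)
    (i : 'I_n.+1) : R -> 'rV[R]_3 :=
  if i == ord0 then body_x f else body_y n m1 m2 f r theta i.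

Definition masses (R : realType) (n : nat) (m1 m2 : R) (i : 'I_n.+1) : R :=
  if i == ord0 then m1 else m2.

(* e^{i x} for real x *)
Definition expi (R : realType) (x : R) : R[i] := (cos x +i* sin x)%C.

Definition a_coef (R : realType) (n : nat) : R[i] :=
  \sum_(1 <= j < n)
    (1 - expi (2 * pi * j%:R / n%:R : R))
    / `|expi (2 * pi * j%:R / n%:R : R) - 1| ^+ 3.

(* Main.v *)
(* With phi_j the angle of y^j, the planar acceleration of y^j is (u, v) and its
   planar force is (P, 0) in the frame rotated by phi_j, where
   u = r'' - r theta'^2 and v = 2 r' theta' + r theta''; none of u, v, P depends
   on j. The body x contributes - m1 r / h^3 to P. The other vertices contribute
   - a_n m2 / r^2, and nothing transversally because
   sin d / |e^{i d} - 1|^3 is odd and is summed over all the angles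
   d = 2 pi k / n; this also makes a_n real. The system thus reduces to the
   equation of f together with u = P and v = 0, and r v = (r^2 theta')' turns
   the last equation into conservation of angular momentum. *)
Require Import Defs.
From mathcomp Require Import realfun ring lra.

Set Implicit Arguments.
Unset Strict Implicit.
Unset Printing Implicit Defensive.

Import Order.TTheory GRing.Theory Num.Theory numFieldNormedType.Exports.

Local Open Scope ring_scope.
Local Open Scope classical_set_scope.

(** * Vectors with three coordinates and their Euclidean norm *)

Section Vec3.
Context {R : realType}.
Implicit Types (a b c k : R).

Lemma vec3D a b c a' b' c' :
  vec3 a b c + vec3 a' b' c' = vec3 (a + a') (b + b') (c + c').
Proof. by apply/rowP => -[[|[|[|]]]]// ?; rewrite !mxE. Qed.

Lemma vec3B a b c a' b' c' :
  vec3 a b c - vec3 a' b' c' = vec3 (a - a') (b - b') (c - c').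
Proof. by apply/rowP => -[[|[|[|]]]]// ?; rewrite !mxE. Qed.

Lemma scale_vec3 k a b c : k *: vec3 a b c = vec3 (k * a) (k * b) (k * c).
Proof. by apply/rowP => -[[|[|[|]]]]// ?; rewrite !mxE. Qed.

Lemma vec30 : vec3 0 0 0 = 0 :> 'rV[R]_3.
Proof. by apply/rowP => -[[|[|[|]]]]// ?; rewrite !mxE. Qed.

Lemma sum_vec3 (n : nat) (a b c : 'I_n -> R) :
  \sum_(k < n) vec3 (a k) (b k) (c k) =
  vec3 (\sum_(k < n) a k) (\sum_(k < n) b k) (\sum_(k < n) c k).
Proof.
by apply/rowP => -[[|[|[|]]]]// ?; rewrite summxE !mxE; apply: eq_bigr => k _;
  rewrite mxE.
Qed.

Lemma vec3_inj a b c a' b' c' :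
  vec3 a b c = vec3 a' b' c' -> [/\ a = a', b = b' & c = c'].
Proof.
move=> /rowP e; split.
- by have := e (@Ordinal 3 0 isT); rewrite !mxE.
- by have := e (@Ordinal 3 1 isT); rewrite !mxE.
- by have := e (@Ordinal 3 2 isT); rewrite !mxE.
Qed.

Lemma euclid_norm_vec3 a b c :
  euclid_norm (vec3 a b c) = Num.sqrt (a ^+ 2 + b ^+ 2 + c ^+ 2).
Proof.
by rewrite /euclid_norm !big_ord_recl big_ord0 addr0 !mxE /= addrA.
Qed.

Lemma euclid_normB d (u v : 'rV[R]_d) :
  euclid_norm (u - v) = euclid_norm (v - u).
Proof.
rewrite /euclid_norm; congr Num.sqrt; apply: eq_bigr => k _.
by rewrite -opprB mxE sqrrN.
Qed.

End Vec3.

(** * Derivatives on open sets and intervals, and in polar coordinates *)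

Section Derivatives.
Context {R : realType}.

Lemma is_derive_vec3 (a b c : R -> R) (t da db dc : R) :
  is_derive t 1 a da -> is_derive t 1 b db -> is_derive t 1 c dc ->
  is_derive t 1 (fun s => vec3 (a s) (b s) (c s)) (vec3 da db dc).
Proof.
move=> ha hb hc.
have h (i : 'I_1) (k : 'I_3) :
    is_derive t 1 (fun s => vec3 (a s) (b s) (c s) i k) (vec3 da db dc i k).
  have -> : (fun s => vec3 (a s) (b s) (c s) i k) =
      nth (fun=> 0) [:: a; b; c] k.
    by apply/funext => s; rewrite mxE; case: k => -[|[|[|]]].
  by rewrite mxE; case: k => -[|[|[|]]].
have dM : derivable (fun s => vec3 (a s) (b s) (c s)) t 1.
  by apply/derivable_mxP => i k; case: (h i k).
apply: DeriveDef => //; rewrite derive_mx//.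
by apply/matrixP => i k; rewrite mxE; exact: derive_val.
Qed.

(** Since [I] is open, [dp] agrees with the derivative of [p] near [t], so the derivative of [dp] at
    [t] is the second derivative of [p], whatever [p] does outside [I]. *)
Lemma derive1n2_open (V : normedModType R) (I : set R) (p dp : R -> V)
    (ddp : V) (t : R) : open I -> I t ->
    (forall s, I s -> is_derive s 1 p (dp s)) -> is_derive t 1 dp ddp ->
  [/\ derivable p t 1, derivable p^`() t 1 & p^`(2) t = ddp].
Proof.
move=> oI It hp hdp.
have e : \near t, dp t = p^`() t.
  near=> s; have Is : I s by near: s; exact: open_nbhs_nbhs.
  by have hs := hp s Is; rewrite derive1E derive_val.
have h2 := near_eq_is_derive e hdp.
split; [by case: (hp t It) | by case: h2 |].
by rewrite derive1nS derive1n1 derive1E derive_val.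
Unshelve. all: by end_near. Qed.

(** Mean value theorem on the segment between [x] and [y], which lies in the interval [I]. *)
Lemma is_derive_0_is_cst_on (I : set R) (g : R -> R) (x y : R) :
  is_interval I -> (forall t, I t -> is_derive t 1 g 0) -> I x -> I y ->
  g x = g y.
Proof.
move=> Iitv dg; wlog xy : x y / x <= y.
  by move=> H Ix Iy; case: (leP x y) => [|/ltW] /H ->.
move=> Ix Iy.
have Ixy t : x <= t <= y -> I t by exact: Iitv.
have dgi t : t \in `]x, y[%R -> is_derive t 1 g ((fun=> 0) t).
  by rewrite in_itv /= => /andP[/ltW xt /ltW ty]; apply/dg/Ixy/andP.
have cg : {within `[x, y], continuous g}.
  apply: derivable_within_continuous => t.
  by rewrite in_itv => /Ixy /dg[].
have [c _] := MVT_segment xy dgi cg.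
by rewrite mul0r => /eqP; rewrite subr_eq0 => /eqP.
Qed.

Lemma smooth_is_derive (I : set R) (g : R -> R) (k : nat) (t : R) :
  smooth_on I g -> I t -> is_derive t 1 g^`(k) (g^`(k.+1) t).
Proof.
by move=> sg It; rewrite derive1nS derive1E; apply: derivableP; exact: sg.
Qed.

(** The amplitude [a] is arbitrary because the rule serves first for r, then for r' and r theta' in
    the second derivative. *)
Lemma is_derive_mul_cos (a th : R -> R) (t da dth c : R) :
  is_derive t 1 a da -> is_derive t 1 th dth ->
  is_derive t 1 (fun s => a s * cos (th s + c))
    (da * cos (th t + c) - a t * dth * sin (th t + c)).
Proof.
move=> ha hth.
have hc : is_derive t 1 (fun s => cos (th s + c)) (- sin (th t + c) * dth).
  apply: (@is_derive1_comp _ cos (fun s => th s + c)).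
  by apply: is_derive_eq; rewrite addr0.
apply: (is_derive_eq (is_deriveM ha hc)).
by rewrite /GRing.scale /=; ring.
Qed.

Lemma is_derive_mul_sin (a th : R -> R) (t da dth c : R) :
  is_derive t 1 a da -> is_derive t 1 th dth ->
  is_derive t 1 (fun s => a s * sin (th s + c))
    (da * sin (th t + c) + a t * dth * cos (th t + c)).
Proof.
move=> ha hth.
have hc : is_derive t 1 (fun s => sin (th s + c)) (cos (th t + c) * dth).
  apply: (@is_derive1_comp _ sin (fun s => th s + c)).
  by apply: is_derive_eq; rewrite addr0.
apply: (is_derive_eq (is_deriveM ha hc)).
by rewrite /GRing.scale /=; ring.
Qed.

(** The two coefficients are the radial and transversal accelerations in polar coordinates. *)
Lemma is_derive_polar2_cos (a da th dth : R -> R) (t dda ddth c : R) :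
  is_derive t 1 a (da t) -> is_derive t 1 th (dth t) ->
  is_derive t 1 da dda -> is_derive t 1 dth ddth ->
  is_derive t 1 (fun s => da s * cos (th s + c) - a s * dth s * sin (th s + c))
    ((dda - a t * dth t ^+ 2) * cos (th t + c)
     - (2 * da t * dth t + a t * ddth) * sin (th t + c)).
Proof.
move=> ha hth hda hdth.
have h1 := is_derive_mul_cos c hda hth.
have hm : is_derive t 1 (fun s => a s * dth s) (a t * ddth + dth t * da t).
  exact: is_deriveM.
have h2 := is_derive_mul_sin c hm hth.
apply: (is_derive_eq (is_deriveB h1 h2)).
by rewrite /GRing.scale /=; ring.
Qed.

Lemma is_derive_polar2_sin (a da th dth : R -> R) (t dda ddth c : R) :
  is_derive t 1 a (da t) -> is_derive t 1 th (dth t) ->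
  is_derive t 1 da dda -> is_derive t 1 dth ddth ->
  is_derive t 1 (fun s => da s * sin (th s + c) + a s * dth s * cos (th s + c))
    ((dda - a t * dth t ^+ 2) * sin (th t + c)
     + (2 * da t * dth t + a t * ddth) * cos (th t + c)).
Proof.
move=> ha hth hda hdth.
have h1 := is_derive_mul_sin c hda hth.
have hm : is_derive t 1 (fun s => a s * dth s) (a t * ddth + dth t * da t).
  exact: is_deriveM.
have h2 := is_derive_mul_cos c hm hth.
apply: (is_derive_eq (is_deriveD h1 h2)).
by rewrite /GRing.scale /=; ring.
Qed.

End Derivatives.

(** * Sums over the arguments of the n-th roots of unity *)

Section RootSums.
Context {R : realType}.
Implicit Types (g : R -> R) (x y : R) (n j k : nat).

(** The argument of e^{2 pi i k/n}, bracketed as in [a_coef] so that it folds there. *)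
Definition root_arg n k : R := 2 * pi * k%:R / n%:R.

Lemma root_arg0 n : root_arg n 0 = 0.
Proof. by rewrite /root_arg mulr0 mul0r. Qed.

Lemma root_argD n j k : root_arg n (j + k) = root_arg n j + root_arg n k.
Proof. by rewrite /root_arg natrD mulrDr mulrDl. Qed.

Lemma root_arg_id n : (0 < n)%N -> root_arg n n = pi *+ 2.
Proof. by move=> n0; rewrite /root_arg mulfK ?pnatr_eq0 -?lt0n// mulr_natl. Qed.

(** The shift permutes the roots cyclically: the last term on the left has angle x + 2 pi and equals
    the first term on the right. *)
Lemma sum_root_shift1 g n x : periodic g (pi *+ 2) ->
  \sum_(k < n) g (x + root_arg n 1 + root_arg n k) =
  \sum_(k < n) g (x + root_arg n k).
Proof.
case: n => [|n] gP; first by rewrite !big_ord0.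
rewrite big_ord_recr [RHS]big_ord_recl /= root_arg0 addr0 addrC.
rewrite -addrA -root_argD add1n root_arg_id// gP; congr (_ + _).
by apply: eq_bigr => k _; rewrite -addrA -root_argD.
Qed.

Lemma sum_root_shift g n j x : periodic g (pi *+ 2) ->
  \sum_(k < n) g (x + root_arg n j + root_arg n k) =
  \sum_(k < n) g (x + root_arg n k).
Proof.
move=> gP; elim: j => [|j IH]; first by rewrite root_arg0 addr0.
by rewrite -add1n addnC root_argD addrA sum_root_shift1.
Qed.

(** The shift by j applied at x = - [root_arg n j]: every vertex sees the polygon under the same
    angles modulo 2 pi. *)
Lemma sum_root_diff g n j : periodic g (pi *+ 2) ->
  \sum_(k < n) g (root_arg n k - root_arg n j) = \sum_(k < n) g (root_arg n k).
Proof.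
move=> gP.
under eq_bigr do rewrite addrC.
rewrite -(sum_root_shift _ j)//.
by apply: eq_bigr => k _; rewrite addNr add0r.
Qed.

(* The substitution k |-> n - 1 - k turns the sum into its opposite shifted by
   one root. *)
Lemma sum_root_odd g n : periodic g (pi *+ 2) -> (forall x, g (- x) = - g x) ->
  \sum_(k < n) g (root_arg n k) = 0.
Proof.
move=> gP gN; set S := (LHS).
suff: S = - S by move=> SN; lra.
rewrite {1}/S (reindex_inj rev_ord_inj)/=.
transitivity (- \sum_(k < n) g (0 + root_arg n 1 + root_arg n k)); last first.
  by rewrite sum_root_shift1//; congr (- _); apply: eq_bigr => k; rewrite add0r.
rewrite -sumrN; apply: eq_bigr => k _; rewrite -gN -(gP (- _)); congr (g _).
have n0 : (0 < n)%N by case: (n) k => [[]|].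
rewrite add0r -root_argD add1n -[_ *+ 2](root_arg_id n0).
have -> : root_arg n n = root_arg n (n - k.+1) + root_arg n k.+1.
  by rewrite -root_argD subnK.
by rewrite addrC addrK.
Qed.

(** Half-angle formula cos x = 1 - 2 sin^2(x/2), with x/2 strictly between 0 and pi. *)
Lemma cos_lt1 x : 0 < x < pi *+ 2 -> cos x < 1.
Proof.
move=> /andP[x0 x2]; rewrite mulr2n in x2.
have s0 : 0 < sin (x / 2) by apply: sin_gt0_pi; apply/andP; split; lra.
have -> : cos x = 1 - sin (x / 2) ^+ 2 *+ 2.
  have {1}-> : x = (x / 2) *+ 2 by rewrite -mulr_natr divfK// pnatr_eq0.
  by rewrite cos_mulr2n cos2sin2; ring.
by have := exprn_gt0 2 s0; rewrite mulr2n; lra.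
Qed.

Lemma cos_root_arg_lt1 n k : (0 < k < n)%N -> cos (root_arg n k) < 1.
Proof.
move=> /andP[k0 kn]; have n0 : (0 < n)%N by exact: leq_trans kn.
have pi0 := @pi_gt0 R.
apply: cos_lt1; rewrite /root_arg; apply/andP; split.
  by rewrite divr_gt0 ?mulr_gt0 ?ltr0n.
by rewrite ltr_pdivrMr ?ltr0n// -(mulr_natl pi) ltr_pM2l ?mulr_gt0// ltr_nat.
Qed.

(* Rotating the polygon by one step fixes the sum of its vertices. *)
Lemma sum_root_cos_sin n x : (1 < n)%N ->
  \sum_(k < n) cos (x + root_arg n k) = 0 /\
  \sum_(k < n) sin (x + root_arg n k) = 0.
Proof.
move=> n1; set C := \sum_(k < n) _; set S := \sum_(k < n) _.
pose a := root_arg n 1.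
have a1 : cos a < 1 by apply: cos_root_arg_lt1.
have eC : C = C * cos a - S * sin a.
  rewrite {1}/C -sum_root_shift1; last exact: cosD2pi.
  rewrite !mulr_suml -sumrB; apply: eq_bigr => k _.
  by rewrite -cosD addrAC.
have eS : S = S * cos a + C * sin a.
  rewrite {1}/S -sum_root_shift1; last exact: sinD2pi.
  rewrite !mulr_suml -big_split; apply: eq_bigr => k _ /=.
  by rewrite -sinD addrAC.
(* The determinant of the identity minus the rotation by [a], nonzero because cos a < 1; the
   identities below are Cramer's rule. *)
have nz : (1 - cos a) ^+ 2 + sin a ^+ 2 != 0 by rewrite gt_eqF//; nra.
split; apply: (mulfI nz); rewrite mulr0.
- have -> : ((1 - cos a) ^+ 2 + sin a ^+ 2) * C =
    (1 - cos a) * (C - (C * cos a - S * sin a))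
    - sin a * (S - (S * cos a + C * sin a)) by ring.
  by rewrite -eC -eS !subrr !mulr0 subrr.
- have -> : ((1 - cos a) ^+ 2 + sin a ^+ 2) * S =
    (1 - cos a) * (S - (S * cos a + C * sin a))
    + sin a * (C - (C * cos a - S * sin a)) by ring.
  by rewrite -eC -eS !subrr !mulr0 addr0.
Qed.

(** The length |e^{ix} - 1| of a chord of the unit circle. *)
Definition chord x : R := Num.sqrt (2 - 2 * cos x).

Lemma chord_periodic : periodic chord (pi *+ 2).
Proof. by move=> x; rewrite /chord cosD2pi. Qed.

(* The term k = 0 is the junk value 0 / 0 = 0. *)
Definition a_real n : R :=
  \sum_(k < n) (1 - cos (root_arg n k)) / chord (root_arg n k) ^+ 3.

(** The summand is odd and periodic. This kills both the imaginary part of [a_coef] and the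
    transversal pull of the other vertices. *)
Lemma sum_sin_chord n :
  \sum_(k < n) sin (root_arg n k) / chord (root_arg n k) ^+ 3 = 0.
Proof.
apply: (sum_root_odd (g := fun x => sin x / chord x ^+ 3)) => x.
  by rewrite sinD2pi chord_periodic.
by rewrite sinN /chord cosN mulNr.
Qed.

Lemma sum_complex n (a b : 'I_n -> R) :
  \sum_(k < n) (a k +i* b k)%C = ((\sum_(k < n) a k) +i* (\sum_(k < n) b k))%C.
Proof.
elim: n a b => [|n IH] a b; first by rewrite !big_ord0.
by rewrite !big_ord_recl IH; simpc.
Qed.

Lemma a_coefE n : a_coef R n = (a_real n)%:C%C.
Proof.
case: n => [|n]; first by rewrite /a_coef /a_real big_geq// big_ord0.
have -> : a_coef R n.+1 = \sum_(k < n.+1)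
   ((1 - cos (root_arg n.+1 k)) / chord (root_arg n.+1 k) ^+ 3 +i*
    - (sin (root_arg n.+1 k) / chord (root_arg n.+1 k) ^+ 3))%C.
  (* [a_coef] starts at j = 1; the extra term k = 0 vanishes, its numerators being 1 - cos 0 and sin
     0. *)
  rewrite big_ord_recl /= root_arg0 cos0 sin0 subrr !mul0r oppr0 add0r.
  rewrite /a_coef big_add1 big_mkord; apply: eq_bigr => k _.
  rewrite -/(root_arg n.+1 k.+1) -/(root_arg n.+1 (lift ord0 k)) /expi.
  set u := root_arg _ _.
  (* Indeed (cos u - 1)^2 + sin^2 u = 2 - 2 cos u. *)
  have -> : `|(cos u +i* sin u)%C - 1| = (chord u)%:C%C.
    rewrite normc_def /= /chord; congr ((Num.sqrt _)%:C)%C.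
    by have := cos2Dsin2 u; simpc; nra.
  rewrite -rmorphXn -fmorphV; apply/eqP; rewrite eq_complex /=.
  by apply/andP; split; apply/eqP; ring.
by rewrite sum_complex sumrN sum_sin_chord oppr0.
Qed.

End RootSums.


(** * Attraction exerted by a regular polygon *)

Section Attraction.
Context {R : realType}.
Implicit Types (n j k : nat) (m r th z d : R).

(** Vertices are numbered from 0. The signs of [r] and [z] are free, so displacements between a
    vertex and a point of the axis, in either direction, have this form too. *)
Definition vertex n r th z k : 'rV[R]_3 :=
  vec3 (r * cos (th + root_arg n k)) (r * sin (th + root_arg n k)) z.

Lemma vertexN n r th z k : - vertex n r th z k = vertex n (- r) th (- z) k.
Proof. by rewrite /vertex -scaleN1r scale_vec3; congr vec3; ring. Qed.

Lemma euclid_norm_vertex n r th z k :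
  euclid_norm (vertex n r th z k) = Num.sqrt (r ^+ 2 + z ^+ 2).
Proof.
rewrite euclid_norm_vec3; congr (Num.sqrt (_ + _)).
by rewrite -[RHS]mulr1 -(cos2Dsin2 (th + root_arg n k)); ring.
Qed.

(** In complex notation the planar part is r e^{i phi} (e^{i delta} - 1), where only delta depends
    on [k]. *)
Lemma vertexB n r th z j k :
  let phi := th + root_arg n j in
  let delta := root_arg n k - root_arg n j in
  vertex n r th z k - vertex n r th z j =
  vec3 (r * (cos phi * (cos delta - 1) - sin phi * sin delta))
       (r * (sin phi * (cos delta - 1) + cos phi * sin delta)) 0.
Proof.
move=> phi delta; rewrite /vertex vec3B subrr.
have -> : th + root_arg n k = phi + delta by rewrite addrACA subrr addr0.
by rewrite cosD sinD -/phi; congr vec3; ring.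
Qed.

Lemma euclid_norm_vertexB n r th z j k : 0 <= r ->
  euclid_norm (vertex n r th z k - vertex n r th z j) =
  r * chord (root_arg n k - root_arg n j).
Proof.
move=> r0; rewrite vertexB euclid_norm_vec3; set delta := root_arg n k - _.
set phi := th + _.
have -> : (r * (cos phi * (cos delta - 1) - sin phi * sin delta)) ^+ 2 +
    (r * (sin phi * (cos delta - 1) + cos phi * sin delta)) ^+ 2 + 0 ^+ 2 =
    r ^+ 2 * (2 - 2 * cos delta).
  have := cos2Dsin2 phi; have := cos2Dsin2 delta.
  have -> : (r * (cos phi * (cos delta - 1) - sin phi * sin delta)) ^+ 2 +
    (r * (sin phi * (cos delta - 1) + cos phi * sin delta)) ^+ 2 + 0 ^+ 2 =
    r ^+ 2 * (cos phi ^+ 2 + sin phi ^+ 2) *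
    ((cos delta ^+ 2 + sin delta ^+ 2) + 1 - 2 * cos delta) by ring.
  by move=> -> ->; ring.
by rewrite sqrtrM ?sqr_ge0// sqrtr_sqr ger0_norm.
Qed.

(** For j < k the angle difference is [root_arg n (k - j)] with 0 < k - j < n, so its cosine is
    below 1 and the chord is not zero. *)
Lemma vertex_inj n r th z (j k : 'I_n) : 0 < r ->
  vertex n r th z j = vertex n r th z k -> j = k.
Proof.
move=> r0; wlog jk : j k / (j <= k)%N.
  by move=> H; case: (leqP j k) => [/H|/ltnW/H jk /esym/jk].
move=> /eqP e; apply/eqP; move: jk; rewrite leq_eqVlt => /orP[//|jk].
have : euclid_norm (vertex n r th z k - vertex n r th z j) = 0.
  by rewrite (eqP e) subrr -vec30 euclid_norm_vec3 expr0n !addr0 sqrtr0.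
rewrite euclid_norm_vertexB ?ltW// => /eqP.
rewrite mulf_eq0 gt_eqF//= sqrtr_eq0.
have -> : root_arg n k - root_arg n j = root_arg n (k - j) :> R.
  by rewrite -{1}(subnK (ltnW jk)) root_argD addrK.
have : cos (root_arg n (k - j)) < 1 :> R.
  apply: cos_root_arg_lt1; rewrite subn_gt0 jk.
  exact: leq_ltn_trans (leq_subr _ _) (ltn_ord k).
by move=> ? ?; exfalso; lra.
Qed.

(** The horizontal parts cancel because the vertices of the polygon are centred on the axis; [d]
    stands for their common distance to the attracted body. *)
Lemma attraction_to_polygon n m r th z d : (1 < n)%N ->
  \sum_(k < n) (m / d ^+ 3) *: vertex n r th z k =
  vec3 0 0 (n%:R * (m / d ^+ 3) * z).
Proof.
move=> n1; rewrite -scaler_sumr /vertex sum_vec3 -!mulr_sumr.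
have [-> ->] := sum_root_cos_sin th n1.
rewrite scale_vec3 !mulr0 sumr_const card_ord.
by congr vec3; rewrite -mulr_natl; ring.
Qed.

(** In the frame rotated by phi, the terms in 1 - cos add up to [a_real] and those in sin cancel.
    The term k = j is harmless, its displacement being zero. *)
Lemma attraction_in_polygon n m r th z j : 0 < r ->
  let phi := th + root_arg n j in
  \sum_(k < n) (m / euclid_norm (vertex n r th z k - vertex n r th z j) ^+ 3) *:
    (vertex n r th z k - vertex n r th z j) =
  vec3 (- (a_real n * (m / r ^+ 2)) * cos phi)
       (- (a_real n * (m / r ^+ 2)) * sin phi) 0.
Proof.
move=> r0 phi.
pose gc x : R := (1 - cos x) / chord x ^+ 3.
pose gs x : R := sin x / chord x ^+ 3.
pose delta k : R := root_arg n k - root_arg n j.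
have gcP : periodic gc (pi *+ 2).
  by move=> x; rewrite /gc cosD2pi chord_periodic.
have gsP : periodic gs (pi *+ 2).
  by move=> x; rewrite /gs sinD2pi chord_periodic.
have Sc : \sum_(k < n) gc (delta k) = a_real n := sum_root_diff n j gcP.
have Ss : \sum_(k < n) gs (delta k) = 0.
  exact: etrans (sum_root_diff n j gsP) (sum_sin_chord n).
transitivity (\sum_(k < n) vec3
    (- (m / r ^+ 2 * cos phi) * gc (delta k)
     - m / r ^+ 2 * sin phi * gs (delta k))
    (- (m / r ^+ 2 * sin phi) * gc (delta k)
     + m / r ^+ 2 * cos phi * gs (delta k))
    0).
  apply: eq_bigr => k _; rewrite euclid_norm_vertexB ?ltW// vertexB scale_vec3.
  rewrite -/(delta k) -/phi mulr0 /gc /gs exprMn invfM.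
  (* The inverse is generalized because the chord is zero at k = j; the identity is linear in it and
     only r must be nonzero. *)
  move: (chord _ ^+ 3)^-1 => c.
  by congr vec3; field; rewrite gt_eqF.
rewrite sum_vec3 sumrB big_split -!mulr_sumr /= Sc Ss sumr_const mul0rn.
by congr vec3; ring.
Qed.

Lemma sum_attraction n (mu : 'I_n.+1 -> R) (p : 'I_n.+1 -> 'rV[R]_3) i :
  \sum_(j < n.+1 | j != i)
     (mu j / euclid_norm (p j - p i) ^+ 3) *: (p j - p i) =
  (mu ord0 / euclid_norm (p ord0 - p i) ^+ 3) *: (p ord0 - p i) +
  \sum_(k < n) (mu (lift ord0 k) / euclid_norm (p (lift ord0 k) - p i) ^+ 3) *:
     (p (lift ord0 k) - p i).
Proof.
rewrite big_mkcond big_ord_recl; congr (_ + _); [|apply: eq_bigr => k _];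
  by case: eqVneq => [->|//]; rewrite subrr scaler0.
Qed.

End Attraction.

(** Both sides are rotated back by the angle [phi]. *)
Lemma rotation_inj (R : realType) (u v P phi : R) :
  u * cos phi - v * sin phi = P * cos phi ->
  u * sin phi + v * cos phi = P * sin phi -> u = P /\ v = 0.
Proof.
move=> e1 e2; have c := cos2Dsin2 phi; split.
- have -> : u = (u * cos phi - v * sin phi) * cos phi
    + (u * sin phi + v * cos phi) * sin phi.
    by rewrite -[LHS]mulr1 -c; ring.
  by rewrite e1 e2 -[RHS]mulr1 -c; ring.
- have -> : v = (u * sin phi + v * cos phi) * cos phi
    - (u * cos phi - v * sin phi) * sin phi.
    by rewrite -[LHS]mulr1 -c; ring.
  by rewrite e1 e2; ring.
Qed.

(** * Forces and accelerations of the n+1 bodies *)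

Section Bodies.
Context {R : realType}.
Variables (n : nat) (m1 m2 : R) (I : set R) (f r theta : R -> R).
Hypotheses (n_gt1 : (1 < n)%N) (m1_gt0 : 0 < m1) (m2_gt0 : 0 < m2).
Hypotheses (I_open : open I) (r_gt0 : forall t : R, I t -> 0 < r t).
Hypotheses (f_smooth : smooth_on I f) (r_smooth : smooth_on I r)
  (theta_smooth : smooth_on I theta).

(** This ratio keeps the centre of mass at the origin: m1 f + n m2 k0 f = 0. *)
Let k0 : R := - (m1 / (n%:R * m2)).
Let M : R := m1 + n%:R * m2.
Let h (t : R) : R :=
  Num.sqrt (r t ^+ 2 + (M / (n%:R * m2)) ^+ 2 * f t ^+ 2).
Let body := bodies (n := n) m1 m2 f r theta.
(** The radial force per unit mass on any vertex: the other vertices, then the body x. *)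
Let radial (t : R) : R :=
  - (a_real n * (m2 / r t ^+ 2)) - m1 * r t / h t ^+ 3.

(** The angle of y^j contains j - 1, so y^(k+1) is vertex k. *)
Lemma body_yE k t :
  body_y n m1 m2 f r theta k.+1 t = vertex n (r t) (theta t) (k0 * f t) k.
Proof.
rewrite /body_y /vertex /root_arg -(natr1 k) addrK.
by have -> : 2 * k%:R * pi / n%:R = 2 * pi * k%:R / n%:R :> R by ring.
Qed.

Lemma bodies_lift (k : 'I_n) t :
  body (lift ord0 k) t = vertex n (r t) (theta t) (k0 * f t) k.
Proof. by rewrite /body /bodies -body_yE. Qed.

Lemma nm2_neq0 : n%:R * m2 != 0.
Proof. by rewrite mulf_neq0 ?gt_eqF// ltr0n ltnW. Qed.

(** The height k0 f - f equals - (M / (n m2)) f, which explains the coefficient of f^2 in [h]. *)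
Lemma bodies_lift_sub0 (k : 'I_n) t :
  body (lift ord0 k) t - body ord0 t =
  vertex n (r t) (theta t) (- (M / (n%:R * m2)) * f t) k.
Proof.
rewrite bodies_lift /body /bodies /= /body_x /vertex vec3B !subr0.
by congr vec3; rewrite /k0 /M mulrDl divff ?nm2_neq0//; ring.
Qed.

Lemma distance_center (k : 'I_n) t :
  euclid_norm (body (lift ord0 k) t - body ord0 t) = h t.
Proof.
by rewrite bodies_lift_sub0 euclid_norm_vertex /h; congr Num.sqrt; ring.
Qed.

Lemma h_gt0 t : I t -> 0 < h t.
Proof.
move=> /r_gt0 r0; rewrite /h sqrtr_gt0.
by rewrite ltr_pwDl ?exprn_gt0// mulr_ge0 ?sqr_ge0.
Qed.

(** A vertex is at distance h > 0 from x, and distinct vertices differ since r > 0. *)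
Lemma bodies_neq (i j : 'I_n.+1) t : I t -> i != j -> body i t != body j t.
Proof.
move=> It; have h0 (k : 'I_n) : body (lift ord0 k) t != body ord0 t.
  apply/eqP => e; have := distance_center k t.
  rewrite e subrr -vec30 euclid_norm_vec3 expr0n !addr0 sqrtr0 => e0.
  by have := h_gt0 It; rewrite -e0 ltxx.
case: (unliftP ord0 i) => [k ->|->]; case: (unliftP ord0 j) => [l ->|->];
  rewrite ?eqxx// => kl.
- apply: contra kl => /eqP; rewrite !bodies_lift.
  by move=> /(vertex_inj (r_gt0 It)) ->.
- by rewrite eq_sym.
Qed.

Lemma force_center t :
  \sum_(j < n.+1 | j != ord0)
    (masses m1 m2 j / euclid_norm (body j t - body ord0 t) ^+ 3)
      *: (body j t - body ord0 t)
  = vec3 0 0 (- (M * f t / h t ^+ 3)).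
Proof.
rewrite (sum_attraction (masses m1 m2) (body ^~ t)) subrr scaler0 add0r.
under eq_bigr do rewrite distance_center bodies_lift_sub0.
rewrite attraction_to_polygon//; congr vec3; rewrite /masses /=.
move: (h t ^+ 3)^-1 => c; field.
by rewrite gt_eqF// pnatr_eq0 -lt0n ltnW.
Qed.

(** The vertical component is [k0] times the one at the centre, so the vertical equation of each
    vertex follows from the equation of f. *)
Lemma force_vertex (k : 'I_n) t : I t ->
  let phi := theta t + root_arg n k in
  \sum_(j < n.+1 | j != lift ord0 k)
    (masses m1 m2 j / euclid_norm (body j t - body (lift ord0 k) t) ^+ 3)
      *: (body j t - body (lift ord0 k) t)
  = vec3 (radial t * cos phi) (radial t * sin phi)
      (k0 * - (M * f t / h t ^+ 3)).
Proof.
move=> It phi; rewrite (sum_attraction (masses m1 m2) (body ^~ t)).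
under eq_bigr do rewrite !bodies_lift.
rewrite (attraction_in_polygon n m2 (theta t) (k0 * f t) k (r_gt0 It)).
rewrite euclid_normB distance_center -opprB bodies_lift_sub0 vertexN.
rewrite scale_vec3 vec3D -/phi /masses /= /radial /k0.
move: (h t ^+ 3)^-1 => c; congr vec3; [by ring|by ring|].
by rewrite addr0; field; rewrite gt_eqF// pnatr_eq0 -lt0n ltnW.
Qed.

Lemma acceleration_center t : I t ->
  [/\ derivable (body ord0) t 1, derivable (body ord0)^`() t 1
    & (body ord0)^`(2) t = vec3 0 0 (derive1n 2 f t)].
Proof.
move=> It; apply: (
  derive1n2_open (dp := fun s => vec3 0 0 (derive1n 1 f s)) I_open It).
  move=> s Is; apply: is_derive_vec3; [exact: is_derive_cst..|].
  exact: (smooth_is_derive 0 f_smooth Is).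
apply: is_derive_vec3; [exact: is_derive_cst..|].
exact: (smooth_is_derive 1 f_smooth It).
Qed.

(** The angle of a vertex differs from theta by a constant, so u and v are the same for all
    vertices. *)
Lemma acceleration_vertex (k : 'I_n) t : I t ->
  let phi := theta t + root_arg n k in
  let u := derive1n 2 r t - r t * derive1n 1 theta t ^+ 2 in
  let v := 2 * derive1n 1 r t * derive1n 1 theta t + r t * derive1n 2 theta t in
  [/\ derivable (body (lift ord0 k)) t 1,
      derivable (body (lift ord0 k))^`() t 1
    & (body (lift ord0 k))^`(2) t =
      vec3 (u * cos phi - v * sin phi) (u * sin phi + v * cos phi)
        (k0 * derive1n 2 f t)].
Proof.
move=> It phi u v.
have -> : body (lift ord0 k) =
    (fun s => vertex n (r s) (theta s) (k0 * f s) k).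
  by apply/funext => s; exact: bodies_lift.
pose c : R := root_arg n k.
have df i s : I s ->
    is_derive s 1 (fun s => k0 * derive1n i f s) (k0 * derive1n i.+1 f s).
  by move=> Is; apply: is_deriveZ; exact: smooth_is_derive f_smooth Is.
apply: (derive1n2_open (dp := fun s => vec3
    (derive1n 1 r s * cos (theta s + c)
     - r s * derive1n 1 theta s * sin (theta s + c))
    (derive1n 1 r s * sin (theta s + c)
     + r s * derive1n 1 theta s * cos (theta s + c))
    (k0 * derive1n 1 f s)) I_open It).
  move=> s Is.
  have dr := smooth_is_derive 0 r_smooth Is.
  have dth := smooth_is_derive 0 theta_smooth Is.
  apply: is_derive_vec3; [exact: is_derive_mul_cos|exact: is_derive_mul_sin|].
  exact: (df 0%N).
have dr := smooth_is_derive 0 r_smooth It.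
have dth := smooth_is_derive 0 theta_smooth It.
have ddr := smooth_is_derive 1 r_smooth It.
have ddth := smooth_is_derive 1 theta_smooth It.
have hx := @is_derive_polar2_cos R r (derive1n 1 r) theta (derive1n 1 theta)
  t _ _ c dr dth ddr ddth.
have hy := @is_derive_polar2_sin R r (derive1n 1 r) theta (derive1n 1 theta)
  t _ _ c dr dth ddr ddth.
exact: is_derive_vec3 hx hy (df 1%N t It).
Qed.

Lemma nbody_solution_polar :
  nbody_solution I (masses m1 m2) body <->
  forall t, I t ->
    [/\ derive1n 2 f t = - (M * f t / h t ^+ 3),
        derive1n 2 r t - r t * derive1n 1 theta t ^+ 2 = radial t
      & 2 * derive1n 1 r t * derive1n 1 theta t + r t * derive1n 2 theta t = 0].
Proof.
split=> [sol t It|eqs t It].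
  have [_ acc] := sol t It.
  have [_ _ acc0] := acceleration_center It.
  (* One vertex suffices, as the radial and transversal equations do not depend on it. *)
  pose k : 'I_n := Ordinal (ltnW n_gt1).
  have [_ _ acck] := acceleration_vertex k It.
  have [_ _] := acc ord0; rewrite force_center acc0 => /vec3_inj[_ _ ->].
  have [_ _] := acc (lift ord0 k).
  rewrite force_vertex// acck => /vec3_inj[e1 e2 _].
  by have [-> ->] := rotation_inj e1 e2.
have [ef eu ev] := eqs t It.
split=> [i j|i]; first exact: bodies_neq.
case: (unliftP ord0 i) => [k ->|->].
  have [d1 d2 ->] := acceleration_vertex k It; split=> //.
  by rewrite force_vertex// ef eu ev !mul0r subr0 addr0.
have [d1 d2 ->] := acceleration_center It; split=> //.
by rewrite force_center ef.
Qed.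

End Bodies.

(** * Conservation of angular momentum and the reduced system *)

Lemma angular_momentum_cst (R : realType) (I : set R) (r theta : R -> R)
    (c : R) :
  open I -> is_interval I -> I 0 ->
  smooth_on I r -> smooth_on I theta -> (forall t, I t -> 0 < r t) ->
  c = r 0 ^+ 2 * derive1n 1 theta 0 ->
  (forall t, I t ->
    2 * derive1n 1 r t * derive1n 1 theta t + r t * derive1n 2 theta t = 0) <->
  (forall t, I t -> r t ^+ 2 * derive1n 1 theta t = c).
Proof.
move=> oI Iitv I0 sr sth r0 ->.
pose L (t : R) := r t ^+ 2 * derive1n 1 theta t.
(* The angular momentum r^2 theta' has derivative r times the transversal acceleration. *)
have dL t : I t -> is_derive t 1 L
    (r t * (2 * derive1n 1 r t * derive1n 1 theta t
            + r t * derive1n 2 theta t)).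
  move=> It; have dr := smooth_is_derive 0 sr It.
  have ddth := smooth_is_derive 1 sth It.
  have dr2 : is_derive t 1 (fun s => r s ^+ 2) (2 * r t * derive1n 1 r t).
    apply: (is_derive_eq (is_deriveX 2 dr)).
    by rewrite /GRing.scale /= expr1 mulr_natl.
  apply: (is_derive_eq (is_deriveM dr2 ddth)).
  by rewrite /GRing.scale /=; ring.
split=> [e t It|e t It].
  apply: (@is_derive_0_is_cst_on _ I L) => // s Is.
  by apply: (is_derive_eq (dL s Is)); rewrite e// mulr0.
have [_] := dL t It.
(* [L] is constant on the open set [I], hence near [t]; the factor r > 0 is then cancelled. *)
have -> : 'D_1 L t = 0.
  rewrite (@near_eq_derive _ _ _ L (fun=> L 0) t 1) ?derive_cst//.
  near=> s; apply: e; near: s; exact: open_nbhs_nbhs.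
move=> /esym/eqP; rewrite mulf_eq0 gt_eqF ?r0//= => /eqP //.
Unshelve. all: by end_near. Qed.

Theorem theorem4p1 (R : realType) (n : nat) (m1 m2 : R)
    (I : set R) (f r theta : R -> R)
    (n_gt1 : (1 < n)%N) (m1_gt0 : 0 < m1) (m2_gt0 : 0 < m2)
    (I_open : open I) (I_itv : is_interval I) (I_0 : I 0)
    (f_smooth : smooth_on I f) (r_smooth : smooth_on I r)
    (theta_smooth : smooth_on I theta)
    (r_gt0 : forall t : R, I t -> 0 < r t) :
  let h : R -> R := fun t =>
    Num.sqrt (r t ^+ 2 + ((m1 + n%:R * m2) / (n%:R * m2)) ^+ 2 * f t ^+ 2) in
  let y1 : R -> R := fun t => body_y n m1 m2 f r theta 1 t 0 (inord 0) in
  let y2 : R -> R := fun t => body_y n m1 m2 f r theta 1 t 0 (inord 1) in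
  let c1 := y1 0 * derive1 y2 0 - y2 0 * derive1 y1 0 in
  nbody_solution I (masses m1 m2) (@bodies R n m1 m2 f r theta)
  <->
  (forall t : R, I t ->
    [/\ derive1n 2 f t = - ((m1 + n%:R * m2) * f t / h t ^+ 3),
        (derive1n 2 r t)%:C%C =
          (c1 ^+ 2 / r t ^+ 3)%:C%C - a_coef R n * (m2 / r t ^+ 2)%:C%C
          - (m1 * r t / h t ^+ 3)%:C%C
      & r t ^+ 2 * derive1 theta t = c1]).
Proof.
move=> h y1 y2 c1.
(* y^1 is vertex 0, with phase 0, so y1 y2' - y2 y1' is r^2 theta' in polar coordinates. *)
have c1E : c1 = r 0 ^+ 2 * derive1n 1 theta 0.
  have y1E : y1 = fun t => r t * cos (theta t + 0).
    apply/funext => t; rewrite /y1 body_yE /vertex mxE inordK//= root_arg0.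
    by [].
  have y2E : y2 = fun t => r t * sin (theta t + 0).
    apply/funext => t; rewrite /y2 body_yE /vertex mxE inordK//= root_arg0.
    by [].
  have dr := smooth_is_derive 0 r_smooth I_0.
  have dth := smooth_is_derive 0 theta_smooth I_0.
  have [_ d1] := is_derive_mul_cos 0 dr dth.
  have [_ d2] := is_derive_mul_sin 0 dr dth.
  rewrite /c1 !derive1E y1E y2E d1 d2 addr0.
  by rewrite -[RHS]mulr1 -(cos2Dsin2 (theta 0)) /=; ring.
rewrite nbody_solution_polar//.
have Lcst :=
  angular_momentum_cst I_open I_itv I_0 r_smooth theta_smooth r_gt0 c1E.
(* With [a_coef] real, the complex equation for r'' is the image of a real one. *)
rewrite a_coefE.
(* The term c1^2 / r^3 is the centrifugal term r theta'^2. *)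
have radialE t : I t -> r t ^+ 2 * derive1n 1 theta t = c1 ->
    c1 ^+ 2 / r t ^+ 3 = r t * derive1n 1 theta t ^+ 2.
  by move=> It <-; field; rewrite gt_eqF ?r_gt0.
split=> [eqs t It|eqs t It].
  (* Conservation uses the transversal equation on all of [I], not only at [t]. *)
  have L s (Is : I s) : r s ^+ 2 * derive1n 1 theta s = c1.
    by apply: (Lcst.1 _ s Is) => u /eqs[].
  have [ef er _] := eqs t It; split=> //; last exact: L.
  rewrite -!rmorphM -!rmorphB; congr (_%:C)%C.
  rewrite (radialE t It (L t It)).
  by rewrite -[LHS](subrK (r t * derive1n 1 theta t ^+ 2)) er; ring.
have [ef er L] := eqs t It; split=> //.
  move: er; rewrite -!rmorphM -!rmorphB => /complexI ->.
  by rewrite (radialE t It L); ring.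
by apply: (Lcst.2 _ t It) => s /eqs[].
Qed.
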